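(* Let $\alpha\in(0,1]$, let $E\colon\mathbb{R}^n\to\mathbb{R}^n$ be a map and let $B\subseteq\mathbb{R}^n$. If the function $g\colon B\to\mathbb{R}^\alpha$ is generalized $E$-convex on $B$, then $g$ is generalized $E$-quasiconvex on $B$.
   Context: $\mathbb{R}^\alpha=\{a^\alpha : a\in\mathbb{R}\}$ is the real linear fractal set (Yang's fractal real line), with $a^\alpha+b^\alpha=(a+b)^\alpha$, $a^\alpha b^\alpha=(ab)^\alpha$, and $a^\alpha\le b^\alpha$ iff $a\le b$; for $\eta\in[0,1]$, $\eta^\alpha$ denotes the corresponding element of $\mathbb{R}^\alpha$, so that $\eta^\alpha+(1-\eta)^\alpha=1^\alpha$. All notions below refer to one and the same map $E$. A set $B\subseteq\mathbb{R}^n$ is $E$-convex if $\eta E(r_1)+(1-\eta)E(r_2)\in B$ for all $r_1,r_2\in B$, $\eta\in[0,1]$. A function $g\colon B\to\mathbb{R}^\alpha$ is generalized $E$-convex on $B$ if $B$ is $E$-convex and $g(\eta E(r_1)+(1-\eta)E(r_2))\le \eta^\alpha g(E(r_1))+(1-\eta)^\alpha g(E(r_2))$ for all $r_1,r_2\in B$, $\eta\in(0,1)$. A function $g\colon B\to\mathbb{R}^\alpha$ on an $E$-convex set $B$ is generalized $E$-quasiconvex on $B$ if $g(\eta E(r_1)+(1-\eta)E(r_2))\le\max\{g(E(r_1)),g(E(r_2))\}$ for all $r_1,r_2\in B$, $\eta\in[0,1]$. *)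

(* Defs.v *)
From HB Require Import structures.
From mathcomp Require Import all_boot all_order all_algebra.
From mathcomp Require Import classical_sets reals.

Set Implicit Arguments.
Unset Strict Implicit.
Unset Printing Implicit Defensive.

Import Order.TTheory GRing.Theory Num.Theory.

Local Open Scope classical_set_scope.
Local Open Scope ring_scope.

(* The real linear fractal set R^alpha. In this theory [a^alpha] is a formal
   symbol indexed by the real [a], not the real power (otherwise
   [a^alpha + b^alpha = (a + b)^alpha] would fail for alpha < 1); the operations
   and the order are those that the laws of R^alpha prescribe on the bases.
   The range of alpha, ]0, 1], is a hypothesis of the theorems. *)
Record fractal (R : realType) (alpha : R) : Type := FPow { fbase : R }.

Notation "a `^^ alpha" := (@FPow _ alpha a)
  (at level 30, right associativity) : ring_scope.

Section FractalStructure.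
Variables (R : realType) (alpha : R).
Local Notation F := (fractal alpha).
Implicit Types x y z : F.

HB.instance Definition _ := [isNew for @fbase R alpha].
HB.instance Definition _ := [Choice of F by <:].

Definition fadd x y : F := (fbase x + fbase y) `^^ alpha.
Definition fopp x : F := (- fbase x) `^^ alpha.
Definition fmul x y : F := (fbase x * fbase y) `^^ alpha.
Definition fle x y : bool := fbase x <= fbase y.
Definition flt x y : bool := fbase x < fbase y.

Fact faddA : associative fadd.
Proof. by move=> x y z; apply: val_inj; rewrite /= addrA. Qed.
Fact faddC : commutative fadd.
Proof. by move=> x y; apply: val_inj; rewrite /= addrC. Qed.
Fact fadd0 : left_id (0 `^^ alpha) fadd.
Proof. by move=> x; apply: val_inj; rewrite /= add0r. Qed.
Fact faddN : left_inverse (0 `^^ alpha) fopp fadd.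
Proof. by move=> x; apply: val_inj; rewrite /= addNr. Qed.

HB.instance Definition _ := GRing.isZmodule.Build F faddA faddC fadd0 faddN.

Fact fmulA : associative fmul.
Proof. by move=> x y z; apply: val_inj; rewrite /= mulrA. Qed.
Fact fmulC : commutative fmul.
Proof. by move=> x y; apply: val_inj; rewrite /= mulrC. Qed.
Fact fmul1 : left_id (1 `^^ alpha) fmul.
Proof. by move=> x; apply: val_inj; rewrite /= mul1r. Qed.
Fact fmulDl : left_distributive fmul fadd.
Proof. by move=> x y z; apply: val_inj; rewrite /= mulrDl. Qed.
Fact fone_neq0 : 1 `^^ alpha != 0 :> F.
Proof. by apply/eqP => -[] /eqP; rewrite oner_eq0. Qed.

HB.instance Definition _ :=
  GRing.Zmodule_isComNzRing.Build F fmulA fmulC fmul1 fmulDl fone_neq0.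

Fact flt_def x y : flt x y = (y != x) && fle x y.
Proof. by rewrite /flt lt_def. Qed.
Fact fle_anti : antisymmetric fle.
Proof. by move=> x y /le_anti /val_inj. Qed.
Fact fle_trans : transitive fle.
Proof. by move=> y x z; apply: le_trans. Qed.
Fact fle_total : total fle.
Proof. by move=> x y; apply: le_total. Qed.

HB.instance Definition _ := Order.isOrder.Build ring_display F
  flt_def (fun _ _ => erefl) (fun _ _ => erefl) fle_anti fle_trans fle_total.

Lemma fpowD (a b : R) : a `^^ alpha + b `^^ alpha = (a + b) `^^ alpha.
Proof. by []. Qed.
Lemma fpowM (a b : R) : a `^^ alpha * b `^^ alpha = (a * b) `^^ alpha.
Proof. by []. Qed.
Lemma fpow_le (a b : R) : (a `^^ alpha <= b `^^ alpha) = (a <= b).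
Proof. by []. Qed.

End FractalStructure.

Section EConvexity.
Variables (R : realType) (n : nat) (E : 'rV[R]_n -> 'rV[R]_n).

Definition E_convex_set (B : set 'rV[R]_n) : Prop :=
  forall r1 r2 : 'rV[R]_n, B r1 -> B r2 ->
  forall eta : R, 0 <= eta <= 1 -> B (eta *: E r1 + (1 - eta) *: E r2).

(* A function B -> R^alpha is a function on R^n of which only the values on B
   matter: as B is E-convex, all the points at which g is evaluated below lie
   in B (E r1 and E r2 by taking eta = 1 and eta = 0). *)
Definition gen_E_convex (alpha : R) (B : set 'rV[R]_n)
    (g : 'rV[R]_n -> fractal alpha) : Prop :=
  E_convex_set B /\
  forall r1 r2 : 'rV[R]_n, B r1 -> B r2 ->
  forall eta : R, 0 < eta < 1 ->
    g (eta *: E r1 + (1 - eta) *: E r2)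
      <= eta `^^ alpha * g (E r1) + (1 - eta) `^^ alpha * g (E r2).

Definition gen_E_quasiconvex (alpha : R) (B : set 'rV[R]_n)
    (g : 'rV[R]_n -> fractal alpha) : Prop :=
  E_convex_set B /\
  forall r1 r2 : 'rV[R]_n, B r1 -> B r2 ->
  forall eta : R, 0 <= eta <= 1 ->
    g (eta *: E r1 + (1 - eta) *: E r2) <= Order.max (g (E r1)) (g (E r2)).

End EConvexity.

(* Main.v *)
Require Import Defs.
From HB Require Import structures.
From mathcomp Require Import all_boot all_order all_algebra.
From mathcomp Require Import classical_sets reals.

Import Order.TTheory GRing.Theory Num.Theory.

Local Open Scope ring_scope.

(** For [eta] strictly inside the unit interval, generalized E-convexity bounds [g] by a convex
    combination of [g (E r1)] and [g (E r2)], and a convex combination never exceeds a common upper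
    bound of its terms ([fractal_conv_le]), here their maximum. *)

Lemma fractal_conv_le (R : realType) (alpha eta : R) (x y z : fractal alpha) :
  0 <= eta <= 1 -> x <= z -> y <= z ->
  eta `^^ alpha * x + (1 - eta) `^^ alpha * y <= z.
Proof.
case: x y z => [a] [b] [c] /andP[eta0 eta1].
rewrite !fpowM fpowD !fpow_le => ac bc.
(* Splitting the bound with the same weights reduces the claim to a termwise comparison. *)
have -> : c = eta * c + (1 - eta) * c by rewrite -mulrDl subrKC mul1r.
by apply: lerD; apply: ler_wpM2l; rewrite ?subr_ge0.
Qed.

(* At the endpoints, which generalized E-convexity does not constrain, the
   convex combination is [E r2] or [E r1] itself. *)
Theorem theorem2p10 (R : realType) (alpha : R) (halpha : 0 < alpha <= 1)
    (n : nat) (E : 'rV[R]_n -> 'rV[R]_n) (B : set 'rV[R]_n)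
    (g : 'rV[R]_n -> fractal alpha) :
  gen_E_convex E B g -> gen_E_quasiconvex E B g.
Proof.
move=> [BE gE]; split=> // r1 r2 Br1 Br2 eta eta01.
have [->|eta_neq0] := eqVneq eta 0.
  by rewrite scale0r add0r subr0 scale1r le_max lexx orbT.
have [->|eta_neq1] := eqVneq eta 1.
  by rewrite subrr scale0r addr0 scale1r le_max lexx.
have /andP[eta0 eta1] := eta01.
apply: (@le_trans _ _
    (eta `^^ alpha * g (E r1) + (1 - eta) `^^ alpha * g (E r2))).
  by apply: gE => //; rewrite !lt_def eta_neq0 eta0 eq_sym eta_neq1.
by apply: fractal_conv_le => //; rewrite le_max lexx ?orbT.
Qed.
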